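(* Let $p\in(0,1)$ and $\ell\in\mathbb{N}$. There exists a hypergraph $H$ such that $b_p(H)-b_{L,p}(H)>\ell$ and $\frac{b_p(H)}{b_{L,p}(H)}>\ell$.
   Context: A hypergraph $H=(V(H),E(H))$ has a finite nonempty vertex set and a finite collection $E(H)$ of subsets of $V(H)$ called edges (parallel edges allowed). For a proportion $p\in(0,1)$, the proportion-based propagation rule is: if at the end of a round at least $\lceil p|e|\rceil$ vertices of an edge $e$ are on fire, then in the next round all vertices of $e$ catch fire; burned vertices stay burned. Burning game: let $F_0=\emptyset$ and $F_r$ be the set of burned vertices at the end of round $r$. In each round $r\geq 1$, simultaneously, vertices catch fire by propagation from $F_{r-1}$ (no propagation in round 1), and a player chooses a vertex $u_r\notin F_{r-1}$ (a source) and sets it on fire. A burning sequence is a sequence $(u_1,\ldots,u_k)$ of such sources after which every vertex is on fire at the end of round $k$; $b_p(H)$ is the minimum length of a burning sequence. Lazy game: $S\subseteq V(H)$ is a lazy burning set if, setting all of $S$ on fire at once and then repeatedly applying the propagation rule, every vertex eventually catches fire; $b_{L,p}(H)$ is the minimum size of a lazy burning set. *)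

(* Defs.v *)
From mathcomp Require Import all_boot all_order all_algebra.
From mathcomp Require Import boolp reals.

Set Implicit Arguments.
Unset Strict Implicit.
Unset Printing Implicit Defensive.

Import Order.TTheory GRing.Theory Num.Theory.
Local Open Scope ring_scope.

(* Edges form a list, so that parallel edges are allowed; the order of the list
   plays no role below. *)
Record hypergraph := Hypergraph {
  vertex : finType;
  edges : seq {set vertex};
  vertex_nonempty : (0 < #|vertex|)%N }.

Definition least (P : nat -> Prop) (exP : exists n, P n) : nat :=
  ex_minn (P := fun n => `[< P n >])
    (let: ex_intro n Pn := exP in ex_intro _ n (asboolT Pn)).

Lemma leastP (P : nat -> Prop) (exP : exists n, P n) :
  P (least exP) /\ forall n, P n -> (least exP <= n)%N.
Proof.
rewrite /least; case: ex_minnP => m /asboolP Pm min_m; split=> // n Pn.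
by apply: min_m; apply/asboolP.
Qed.

Section Burning.
Variables (R : realType) (p : R) (H : hypergraph).
Implicit Types (F S e : {set vertex H}) (u : seq (vertex H)).

Definition edge_fires F e : bool :=
  Num.ceil (p * #|e|%:R) <= #|e :&: F|%:Z.

Definition propagate F : {set vertex H} :=
  F :|: \bigcup_(e <- edges H | edge_fires F e) e.

(* [fire u] is F_r for the sources u = (u_1, ..., u_r). For 0 < p, propagating
   from F_0 = set0 burns nothing, so round 1 needs no special case. *)
Definition fire u : {set vertex H} :=
  foldl (fun F v => v |: propagate F) set0 u.

Definition burning_sequence u : Prop :=
  (forall x0 r, (r < size u)%N -> nth x0 u r \notin fire (take r u)) /\
  fire u = setT.

Definition lazy_burning_set S : Prop :=
  exists n, iter n propagate S = setT.

Lemma fire_rcons u v : fire (rcons u v) = v |: propagate (fire u).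
Proof. by rewrite /fire -cats1 foldl_cat. Qed.

Lemma burning_sequence_ex :
  exists k, exists u, size u = k /\ burning_sequence u.
Proof.
suff ext n u : (#|~: fire u| <= n)%N ->
    (forall x0 r, (r < size u)%N -> nth x0 u r \notin fire (take r u)) ->
    exists w, burning_sequence w.
  by case: (ext #|~: fire [::]| [::]) => // w Bw; exists (size w), w.
elim: n u => [|n IHn] u le_n ok_u.
  exists u; split=> //; apply: setC_inj.
  by rewrite setCT; apply/eqP; rewrite -cards_eq0 -leqn0.
have [fullF | [v vF]] := set_0Vmem (~: fire u).
  by exists u; split=> //; apply: setC_inj; rewrite setCT.
apply: (IHn (rcons u v)) => [|x0 r].
  rewrite -ltnS; apply: leq_trans le_n; apply: proper_card.
  apply/properP; split; last first.
    by exists v => //; rewrite fire_rcons inE negbK setU11.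
  by rewrite setCS fire_rcons /propagate setUCA subsetUl.
rewrite size_rcons ltnS nth_rcons -cats1 => le_r.
rewrite takel_cat //; case: ltngtP le_r => // [lt_r _|-> _]; first exact: ok_u.
by rewrite take_size -in_setC.
Qed.

Lemma lazy_burning_set_ex :
  exists k, exists S, #|S| = k /\ lazy_burning_set S.
Proof. by exists #|[set: vertex H]|, setT; split=> //; exists 0%N. Qed.

Definition burning_number : nat := least burning_sequence_ex.

Definition lazy_burning_number : nat := least lazy_burning_set_ex.

End Burning.

(* Main.v *)
Require Import Defs.
From mathcomp Require Import all_boot all_order all_algebra.
From mathcomp Require Import boolp reals.
From mathcomp Require Import zify lra.

Set Implicit Arguments.
Unset Strict Implicit.
Unset Printing Implicit Defensive.

Import Order.TTheory GRing.Theory Num.Theory.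
Local Open Scope ring_scope.

(** Choose [k] with [p k <= k - 1], and let the edges be all the [k]-element
    intervals of a path with [n] vertices. An interval with at most one
    unburned vertex fires, so burning the first interval burns everything and
    the lazy number is at most [k], whatever [n] is. On the other hand fire
    travels a distance less than [k] per round, so the number of burned
    vertices grows at most exponentially in the number of rounds, and the
    burning number tends to infinity with [n]. *)

Section Interval.
Local Open Scope nat_scope.

Definition interval n k i : {set 'I_n} := [set j : 'I_n | i <= j < i + k].

Lemma card_interval_le n k i : #|interval n k i| <= k.
Proof.
rewrite cardE -(size_map val) -[leqRHS](size_iota i).
apply: uniq_leq_size; first by rewrite (map_inj_uniq val_inj) enum_uniq.
by move=> _ /mapP[j + ->]; rewrite mem_enum inE mem_iota.
Qed.

Lemma card_interval n k i : i + k <= n -> #|interval n k i| = k.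
Proof.
move=> le_n; apply/eqP; rewrite eqn_leq card_interval_le /=.
rewrite cardE -(size_map val) -[leqLHS](size_iota i).
apply: uniq_leq_size; first exact: iota_uniq.
move=> j; rewrite mem_iota => j_in.
have lt_n : j < n by case/andP: j_in => _ /leq_trans; apply.
by apply/mapP; exists (Ordinal lt_n); rewrite // mem_enum inE.
Qed.

Lemma card_ord_gt0 n : 0 < n -> 0 < #|'I_n|.
Proof. by rewrite card_ord. Qed.

(** Starting points stop at [n - k], so for [k <= n] no edge is cut off by the end of the path and
    all have exactly [k] vertices. *)
Definition interval_hypergraph n k (n_gt0 : 0 < n) : hypergraph :=
  @Hypergraph 'I_n [seq interval n k i | i <- iota 0 (n - k).+1]
    (card_ord_gt0 n_gt0).

End Interval.

Section Growth.
Variables (R : realType) (p : R) (H : hypergraph).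

(** A round multiplies the burned set by at most [C] and adds one source; the strict bound absorbs
    that source in the induction. *)
Lemma card_fire_lt C (u : seq (vertex H)) : (0 < C)%N ->
    (forall F : {set vertex H}, #|propagate p F| <= C * #|F|)%N ->
  (#|fire p u| < C.+1 ^ size u)%N.
Proof.
move=> C_gt0 grow; elim/last_ind: u => [|u v IHu]; first by rewrite cards0.
rewrite fire_rcons size_rcons expnS.
have := grow (fire p u); rewrite cardsU1.
case: (_ \notin _) => /=; nia.
Qed.

(** The growth bound makes [set0] a fixed point of [propagate], so it never burns the nonempty
    vertex set. *)
Lemma lazy_burning_number_gt0 C :
    (forall F : {set vertex H}, #|propagate p F| <= C * #|F|)%N ->
  (0 < lazy_burning_number p H)%N.
Proof.
move=> grow; rewrite lt0n; apply/eqP => lazy0.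
have [+ _] := leastP (lazy_burning_set_ex p H).
rewrite -/(lazy_burning_number p H) lazy0 => -[S [/eqP + [n]]].
rewrite cards_eq0 => /eqP ->.
have -> : iter n (@propagate R p H) set0 = set0 :> {set vertex H}.
  elim: n => //= n ->; apply/eqP; rewrite -cards_eq0 -leqn0.
  by rewrite (leq_trans (grow _)) // cards0 muln0.
by move/eqP; rewrite eq_sym -cards_eq0 cardsT -leqn0 leqNgt vertex_nonempty.
Qed.

Lemma ltn_burning_number C m : (0 < C)%N ->
    (forall F : {set vertex H}, #|propagate p F| <= C * #|F|)%N ->
  (C.+1 ^ m <= #|vertex H|)%N -> (m < burning_number p H)%N.
Proof.
move=> C_gt0 grow le_card; rewrite /burning_number.
have [[u [<- [_ burnt]]] _] := leastP (burning_sequence_ex p H).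
rewrite -(ltn_exp2l _ _ (C_gt0 : 1 < C.+1)%N).
apply: leq_ltn_trans le_card _.
by rewrite -cardsT -burnt; exact: card_fire_lt.
Qed.

End Growth.

Section IntervalBurning.
Variables (R : realType) (p : R) (n k : nat) (n_gt0 : (0 < n)%N).
Hypotheses (k_gt0 : (0 < k)%N) (le_kn : (k <= n)%N).
Notation H := (interval_hypergraph k n_gt0).

Lemma card_propagate_interval : 0 < p -> forall F : {set vertex H},
  (#|propagate p F| <= k.*2 * #|F|)%N.
Proof.
(* Vertices at distance less than [k] from [v] lie in this window of length [2k]; when [v < k] the
   truncated subtraction starts it at 0, which still covers them. *)
move=> p_gt0 F; pose ball (v : 'I_n) := interval n k.*2 (v - k).
suff sub : propagate p F \subset \bigcup_(v in F) ball v.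
  apply: leq_trans (subset_leq_card sub) _.
  rewrite mulnC -sum_nat_const.
  elim/big_rec2: _ => [|v A m _ le_m]; first by rewrite cards0.
  by apply: leq_trans (leq_card_setU _ _) _; rewrite leq_add ?card_interval_le.
rewrite subUset; apply/andP; split.
  by apply/subsetP=> v vF; apply/bigcupP; exists v; rewrite // inE; lia.
rewrite big_seq_cond; elim/big_rec: _ => [|e A]; first exact: sub0set.
case/andP=> /mapP[i]; rewrite mem_iota => i_lt -> fires A_sub.
rewrite subUset A_sub andbT; apply/subsetP=> w.
have card_i : #|interval n k i| = k by apply: card_interval; lia.
(* Since [p * k > 0], the firing threshold is at least 1, so a firing edge already contains a burned
   vertex. *)
have /card_gt0P[v] : (0 < #|interval n k i :&: F|)%N.
  rewrite -ltz_nat; apply: lt_le_trans fires.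
  by rewrite ceil_gt0 card_i mulr_gt0 ?ltr0n.
rewrite !inE => /andP[v_in vF] w_in.
by apply/bigcupP; exists v; rewrite // inE; lia.
Qed.

Lemma lazy_burning_number_interval : p * k%:R <= k.-1%:R ->
  (lazy_burning_number p H <= k)%N.
Proof.
move=> le_p; rewrite /lazy_burning_number.
have [_] := leastP (lazy_burning_set_ex p H); apply.
exists (interval n k 0); split; first exact: card_interval.
(* The burned initial segment gains at least one vertex per round: the edge starting at [m.+1] lacks
   only its last vertex, [k + m]. *)
have burnt m : (m <= n - k)%N ->
    interval n (k + m) 0 \subset
      iter m (@propagate R p H) (interval n k 0).
  elim: m => [_|m IHm lt_m] /=; first by rewrite addn0.
  have sub := IHm (ltnW lt_m).
  apply/subsetP=> w; rewrite inE => w_lt.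
  have [w_lt'|w_ge] := ltnP w (k + m).
    by rewrite inE (subsetP sub) // inE.
  have e_in : interval n k m.+1 \in edges H.
    by apply: map_f; rewrite mem_iota; lia.
  have fires : edge_fires p (iter m (@propagate R p H) (interval n k 0))
      (interval n k m.+1).
    have card_e : #|interval n k m.+1| = k by apply: card_interval; lia.
    rewrite /edge_fires card_e ceil_le_int; apply: le_trans le_p _.
    (* The [k.-1] burned vertices are the edge without its last vertex, again an interval from
       [m.+1]. *)
    rewrite -pmulrn ler_nat -[leqLHS](@card_interval n k.-1 m.+1); last by lia.
    apply: subset_leq_card; rewrite subsetI; apply/andP; split.
      by apply/subsetP=> v; rewrite !inE; lia.
    by apply: subset_trans sub; apply/subsetP=> v; rewrite !inE; lia.
  rewrite inE; apply/orP; right; rewrite (big_rem _ e_in) /= fires inE.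
  by apply/orP; left; rewrite inE; lia.
exists (n - k)%N; apply/eqP; rewrite -subTset.
apply: subset_trans (burnt _ (leqnn _)).
by apply/subsetP=> w _; rewrite inE; have := ltn_ord w; lia.
Qed.

End IntervalBurning.

Theorem theorem2p29 (R : realType) (p : R) (hp0 : 0 < p) (hp1 : p < 1)
    (l : nat) :
  exists H : hypergraph,
    (burning_number p H)%:R - (lazy_burning_number p H)%:R > l%:R :> R /\
    (burning_number p H)%:R / (lazy_burning_number p H)%:R > l%:R :> R.
Proof.
(* The condition amounts to [k >= 1 / (1 - p)], so an Archimedean bound supplies [k]. *)
have [k k_gt0 le_p] : exists2 k, (0 < k)%N & p * k%:R <= k.-1%:R :> R.
  have q_gt0 : 0 < 1 - p by rewrite subr_gt0.
  have q_ge0 : 0 <= (1 - p)^-1 by rewrite invr_ge0 ltW.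
  have := archi_boundP q_ge0; case: (Num.bound _) => [|k] lt_k.
    by move: (le_lt_trans q_ge0 lt_k); rewrite ltxx.
  exists k.+1 => //=; move: lt_k; rewrite -div1r ltr_pdivrMr // -natr1; lra.
(* With growth factor [k.*2] per propagation, this size forces more than [l.+1 * k] rounds, hence
   more than [l.+1] times the lazy number. *)
pose n := (k.*2.+1 ^ (l.+1 * k))%N.
have le_kn : (k <= n)%N.
  have /ltnW : (l.+1 * k < n)%N by rewrite ltn_expl // ltnS double_gt0.
  by apply: leq_trans; rewrite leq_pmull.
have n_gt0 : (0 < n)%N := leq_trans k_gt0 le_kn.
pose H := interval_hypergraph k n_gt0; exists H.
have grow := card_propagate_interval (n_gt0 := n_gt0) k_gt0 le_kn hp0.
have lazy_gt0 := lazy_burning_number_gt0 grow.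
have lazy_le := lazy_burning_number_interval n_gt0 k_gt0 le_kn le_p.
have burn_gt : (l.+1 * k < burning_number p H)%N.
  by apply: (ltn_burning_number _ grow); rewrite ?double_gt0 ?card_ord.
(* Both claims follow from this inequality: the difference exceeds [l] times the lazy number, which
   is at least 1, and positivity also allows the division. *)
have lazy_burn : (l * lazy_burning_number p H + lazy_burning_number p H <
    burning_number p H)%N.
  by apply: leq_ltn_trans burn_gt; rewrite addnC -mulSn leq_mul2l lazy_le orbT.
split.
  rewrite ltrBrDr -natrD ltr_nat; apply: leq_ltn_trans lazy_burn.
  by rewrite leq_add2r leq_pmulr.
rewrite ltr_pdivlMr ?ltr0n // -natrM ltr_nat; apply: leq_ltn_trans lazy_burn.
exact: leq_addr.
Qed.
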